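(* Let $k$ be a positive integer and let $b > 2$ be a real number. Then every colouring of the edges of the complete graph $K_n$ with $k$ colours, where $n > b^k$, contains a monochromatic cycle of odd length at most $2\lceil \log_{b/2} k \rceil + 1$.
   Context: A monochromatic cycle is a cycle all of whose edges receive the same colour.
   Formalization: The formal theorem assumes k ≥ 2 instead of k a positive integer: for k = 1 the bound 2⌈log_{b/2} 1⌉ + 1 equals 1, and no cycle has length at most 1, so the claim fails for every b > 2 and n > b. *)

(* Defs.v *)
From HB Require Import structures.
From mathcomp Require Import all_boot all_order all_algebra.
From mathcomp Require Import all_classical all_reals all_analysis.

Set Implicit Arguments.
Unset Strict Implicit.
Unset Printing Implicit Defensive.

Import Order.TTheory GRing.Theory Num.Theory.

Local Open Scope ring_scope.

Definition edge (n : nat) : finType := {e : {set 'I_n} | #|e| == 2%N}.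

Definition colour_class (n k : nat) (c : edge n -> 'I_k) (i : 'I_k) :
    rel 'I_n :=
  fun x y => [exists e : edge n, (val e == [set x; y]) && (c e == i)].

(* The requirement 2 < size s excludes the degenerate closed sequences
   [:: x; y], which merely traverse one edge back and forth. The length of
   the cycle s, i.e. its number of edges, is size s. *)
Definition is_graph_cycle (T : eqType) (g : rel T) (s : seq T) : bool :=
  [&& (2 < size s)%N, uniq s & cycle g s].

Definition monochromatic_cycle (n k : nat) (c : edge n -> 'I_k)
    (s : seq 'I_n) : Prop :=
  exists i : 'I_k, is_graph_cycle (colour_class c i) s.

Definition logb (R : realType) (a x : R) : R := ln x / ln a.

(* Main.v *)
Require Import Defs.
From HB Require Import structures.
From mathcomp Require Import all_boot all_order all_algebra.
From mathcomp Require Import all_classical all_reals all_analysis.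
From mathcomp Require Import fintype finset zify lra.

Import Order.TTheory GRing.Theory Num.Theory.

Local Open Scope ring_scope.

(* Let r be the ceiling of log_{b/2} k and suppose that no colour has an odd
   cycle of length at most 2r+1. Each vertex keeps a list of available colours,
   initially all k, and weighs b^(-l) where l is the length of its list; the
   invariant is that the colour of an edge between surviving vertices is
   available at both ends. Fix a surviving vertex v. Some colour i has a unit
   ball around v of weight at least 1/k of the total, and since k <= (b/2)^r,
   for some 1 <= j <= r the ball of radius j+1 weighs at most b/2 times the
   ball B of radius j. The endpoints of walks from v of length at most j and of
   a fixed parity are independent in colour i, as an edge would close an odd
   walk of length at most 2j+1; for one parity they form a set S with at least
   half the weight of B. Keep S, delete the rest of the ball of radius j+1, and
   drop colour i from the lists on S: the invariant survives, and so does the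
   total weight since every vertex of S becomes b times heavier. The process
   ends with a single vertex, of weight at most 1, so n b^(-k) <= 1. *)

(** * Closed walks and odd cycles *)

Section ClosedWalks.
Context {T : eqType}.
Implicit Types (g : rel T) (s t : seq T).

Lemma cycle_cat_same {g x s t} :
  cycle g (x :: s ++ x :: t) = cycle g (x :: s) && cycle g (x :: t).
Proof. by rewrite /= rcons_cat cat_path /= [X in _ = X && _]rcons_path andbA. Qed.

Lemma not_uniq_split {s} :
  ~~ uniq s -> exists x s1 s2 s3, s = s1 ++ x :: s2 ++ x :: s3.
Proof.
elim: s => // y s IHs /=; rewrite negb_and negbK => /orP[|/IHs].
  by case/splitPr => s2 s3; exists y, [::], s2, s3.
by case=> x [s1 [s2 [s3 ->]]]; exists x, (y :: s1), s2, s3.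
Qed.

(** A repeated vertex splits a closed walk into two shorter ones, and exactly one of them is odd. *)
Lemma odd_closed_walk_cycle {g s} :
  irreflexive g -> cycle g s -> odd (size s) ->
  exists t, [/\ is_graph_cycle g t, odd (size t) & (size t <= size s)%N].
Proof.
move=> g_irr; have [m] := ubnP (size s); elim: m s => // m IHm s.
rewrite ltnS => le_sm cyc_s odd_s.
have [s_uniq|/not_uniq_split[x [s1 [s2 [s3 def_s]]]]] := boolP (uniq s).
  exists s; split=> //; rewrite /is_graph_cycle s_uniq cyc_s !andbT.
  case: s odd_s cyc_s {le_sm s_uniq} => [|x [|y [|z s]]] //=.
  by rewrite g_irr.
have size_s : size s = ((size s2).+1 + (size (s3 ++ s1)).+1)%N.
  by rewrite def_s !size_cat /= size_cat /=; lia.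
have : cycle g (x :: s2) && cycle g (x :: s3 ++ s1).
  rewrite -cycle_cat_same.
  have -> : x :: s2 ++ x :: s3 ++ s1 = (x :: s2 ++ x :: s3) ++ s1.
    by rewrite /= -catA.
  by rewrite cycle_catC -def_s.
case/andP=> cyc2 cyc31.
have [odd2|even2] := boolP (odd (size (x :: s2))).
  have [|t [? ? le_t]] := IHm _ _ cyc2 odd2; first by rewrite /=; lia.
  by exists t; split=> //; rewrite /= in le_t; lia.
have odd31 : odd (size (x :: s3 ++ s1)) by move: odd_s even2 => /=; lia.
have [|t [? ? le_t]] := IHm _ _ cyc31 odd31; first by rewrite /=; lia.
by exists t; split=> //; rewrite /= in le_t; lia.
Qed.

End ClosedWalks.

(** * Balls and walk parity *)

Section Balls.
Context {T : finType} (g : rel T) (v : T).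

(* Unlike the layers of vertices at distance [d] from [v], these sets may
   overlap. *)
Fixpoint walk_end d : {set T} :=
  if d is d'.+1 then [set y | [exists x in walk_end d', g x y]] else [set v].

Definition ball j := \bigcup_(d < j.+1) walk_end d.

Definition parity_ball (e : bool) j :=
  \bigcup_(d < j.+1 | odd d == e) walk_end d.

Lemma walk_endP {d x} :
  x \in walk_end d -> exists p, [/\ path g v p, last v p = x & size p = d].
Proof.
elim: d x => [|d IHd] x /=; first by rewrite inE => /eqP->; exists [::].
rewrite inE => /exists_inP[y /IHd[p [vp py dp]] gyx].
by exists (rcons p x); rewrite rcons_path vp py last_rcons size_rcons dp.
Qed.

Lemma ball_parity j : ball j = parity_ball false j :|: parity_ball true j.
Proof.
apply/setP => x; rewrite inE; apply/bigcupP/orP => [[d _ xd]|].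
  by case: (boolP (odd d)) => d_par; [right|left]; apply/bigcupP; exists d;
    rewrite ?d_par // (negPf d_par).
by case=> /bigcupP[d _ xd]; exists d.
Qed.

Lemma parity_ball_sub e j : parity_ball e j \subset ball j.
Proof. by apply/bigcupsP => d _; apply: (bigcup_sup d). Qed.

Lemma ball_step {j x y} : x \in ball j -> g x y -> y \in ball j.+1.
Proof.
case/bigcupP=> d _ xd gxy; apply/bigcupP; exists (lift ord0 d) => //.
by rewrite /= inE; apply/exists_inP; exists x.
Qed.

Lemma sub_ballS j : ball j \subset ball j.+1.
Proof.
by apply/bigcupsP => d _; apply: (bigcup_sup (widen_ord (leqnSn _) d)).
Qed.

Lemma center_in_ball j : v \in ball j.
Proof. by apply/bigcupP; exists ord0; rewrite //= inE. Qed.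

Lemma ball_ind {P : pred T} {j x} :
  P v -> (forall y z, g y z -> P z) -> x \in ball j -> P x.
Proof.
move=> Pv Pg /bigcupP[[[|d] ?] _] /=; first by rewrite inE => /eqP->.
by rewrite inE => /exists_inP[y _ /Pg].
Qed.

(* Two adjacent vertices reached from [v] by walks of the same parity close
   an odd walk. *)
Lemma parity_ball_independent {r e j x y} :
  symmetric g ->
  (forall s, cycle g s -> odd (size s) -> (2 * r + 1 < size s)%N) ->
  (j <= r)%N -> x \in parity_ball e j -> y \in parity_ball e j -> ~~ g x y.
Proof.
move=> g_sym no_odd le_jr /bigcupP[d /eqP d_par /walk_endP[p [vp px dp]]].
case/bigcupP=> d' /eqP d'_par /walk_endP[q [vq qy dq]]; apply/negP => gxy.
(* Go from [v] to [x] along [p], cross to [y], return along [q]: the length [d + d' + 1] is odd and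
   at most [2 * j + 1]. *)
have := no_odd (p ++ rev (v :: q)).
rewrite (cycle_path v) last_cat rev_cons last_rcons cat_path vp px.
have -> : path g x (rcons (rev q) v).
  rewrite -rev_cons lastI rev_rcons qy /= gxy -qy rev_path.
  by rewrite (eq_path (e' := g)) // => ? ?; rewrite g_sym.
rewrite size_cat size_rcons size_rev dp dq addnS /= oddD d_par d'_par addbb.
by move=> /(_ isT isT); have := ltn_ord d; have := ltn_ord d'; lia.
Qed.

End Balls.

(** If every step beat the factor [q], then [f r] would exceed [q ^+ r * f 0]. *)
Lemma slow_growth {R : realFieldType} {f : nat -> R} {q : R} {r} :
  0 < q -> (0 < r)%N -> f r <= q ^+ r * f 0%N ->
  exists2 j, (j < r)%N & f j.+1 <= q * f j.
Proof.
move=> q_gt0; elim: r => // r IHr _ fr.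
have [le_f|lt_f] := lerP (f r.+1) (q * f r); first by exists r.
have : q * f r < q * (q ^+ r * f 0%N) by rewrite mulrA -exprS (lt_le_trans lt_f).
rewrite ltr_pM2l // => {}lt_f; case: r => [|r] in IHr fr lt_f *.
  by rewrite expr0 mul1r ltxx in lt_f.
by have [//|j lt_jr ?] := IHr _ (ltW lt_f); exists j => //; apply: ltnW.
Qed.

(** * Weights of vertex sets *)

Section Weight.
Context {R : realFieldType} {T : finType} (w : T -> R).
Context (w_gt0 : forall x, 0 < w x).

Definition weight (A : {set T}) : R := \sum_(x in A) w x.

Lemma weight_sub {A B : {set T}} : A \subset B -> weight A <= weight B.
Proof.
move=> sAB; rewrite /weight [leRHS](big_setID A) /= (setIidPr sAB) lerDl.
by apply: sumr_ge0 => x _; apply: ltW.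
Qed.

Lemma weightD {A B : {set T}} : A \subset B -> weight B = weight A + weight (B :\: A).
Proof. by move=> sAB; rewrite /weight (big_setID A) /= (setIidPr sAB). Qed.

Lemma weightU A B : weight (A :|: B) <= weight A + weight B.
Proof.
rewrite (weightD (subsetUl A B)) lerD2l weight_sub //.
by rewrite setDUl setDv set0U subsetDl.
Qed.

Lemma weight_bigcup (I : finType) (P : pred I) (F : I -> {set T}) :
  weight (\bigcup_(i | P i) F i) <= \sum_(i | P i) weight (F i).
Proof.
elim/big_rec2: _ => [|i x A _ le_Ax]; first by rewrite /weight big_set0.
by apply: le_trans (weightU _ _) _; rewrite lerD2l.
Qed.

Lemma weight_gt0 {A : {set T}} {x} : x \in A -> 0 < weight A.
Proof.
move=> xA; rewrite /weight (bigD1 x) //=; apply: ltr_wpDr => //.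
by apply: sumr_ge0 => y _; apply: ltW.
Qed.

End Weight.

(* [V] is the set of surviving vertices and [L x] the set of colours still
   available at [x]. *)
Lemma available_colours_weight {R : realFieldType} {T C : finType}
    (G : C -> rel T) (b : R) (r : nat) :
  (forall i, symmetric (G i)) ->
  (forall i s, cycle (G i) s -> odd (size s) -> (2 * r + 1 < size s)%N) ->
  2 < b -> (0 < r)%N -> #|C|%:R <= (b / 2) ^+ r ->
  forall (V : {set T}) (L : T -> {set C}),
  (forall x y, x \in V -> y \in V -> x != y ->
     exists i, [/\ i \in L x, i \in L y & G i x y]) ->
  weight (fun x => b^-1 ^+ #|L x|) V <= 1.
Proof.
move=> G_sym no_odd b_gt2 r_gt0 C_le V L.
have b_gt0 : 0 < b by lra.
(* Induct on available pairs rather than on vertices: a round may delete no vertex, but it always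
   drops a colour on a nonempty [S]. *)
pose avail (V : {set T}) (L : T -> {set C}) :=
  [set p : T * C | (p.1 \in V) && (p.2 \in L p.1)].
have [m] := ubnP #|avail V L|; elim: m V L => // m IHm V L.
rewrite ltnS => le_m complete.
set w := fun x => _; have w_gt0 x : 0 < w x by rewrite exprn_gt0 ?invr_gt0.
have [->|[v vV]] := set_0Vmem V; first by rewrite /weight big_set0.
have [Lv0|[i0 i0Lv]] := set_0Vmem (L v).
  have -> : V = [set v].
    apply/setP => x; rewrite inE; apply/idP/eqP => [xV|-> //].
    apply/eqP; apply: contraT => neq_xv.
    by have [i []] := complete _ _ xV vV neq_xv; rewrite Lv0 inE.
  by rewrite /weight big_set1 /w Lv0 cards0.
(* With availability built into the graph, every vertex of a ball around [v] survives and still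
   lists [i]. *)
pose H i : rel T := fun x y =>
  [&& x \in V, y \in V, i \in L x, i \in L y & G i x y].
have H_sym i : symmetric (H i).
  by move=> x y; rewrite /H G_sym; do !case: (_ \in _).
have no_oddH i s : cycle (H i) s -> odd (size s) -> (2 * r + 1 < size s)%N.
  by move=> cyc; apply: (no_odd i); apply: sub_cycle cyc => x y /and5P[].
(* The unit balls around [v] in its available colours cover [V], so the heaviest has at least the
   average weight. *)
have [i iLv i_max] : exists2 i, i \in L v &
    weight w V <= #|C|%:R * weight w (ball (H i) v 1).
  have [i iLv i_max] := arg_maxP (fun i => weight w (ball (H i) v 1)) i0Lv.
  exists i => //; have /(weight_sub w w_gt0) :
      V \subset \bigcup_(i in L v) ball (H i) v 1.
    apply/subsetP => x xV; have [->|neq_xv] := eqVneq x v.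
      by apply/bigcupP; exists i0; rewrite ?center_in_ball.
    have [i1 [i1x i1v Gxv]] := complete _ _ xV vV neq_xv.
    apply/bigcupP; exists i1 => //; apply: (ball_step _ _ (center_in_ball _ _ 0)).
    by rewrite /H xV vV i1x i1v G_sym.
  move=> /le_trans; apply; apply: le_trans (weight_bigcup w w_gt0 _ _ _) _.
  apply: le_trans (ler_sum _ i_max) _; rewrite sumr_const -[leLHS]mulr_natl.
  rewrite ler_wpM2r ?ler_nat ?max_card // ltW //.
  exact: (weight_gt0 w w_gt0 (center_in_ball _ _ _)).
pose B := ball (H i) v.
have inB j x : x \in B j -> (x \in V) && (i \in L x).
  apply: (ball_ind _ _ (P := fun x => (x \in V) && (i \in L x))).
    by rewrite vV.
  by move=> y z /and5P[_ -> _ ->].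
have BV j : B j \subset V by apply/subsetP => x /inB/andP[].
(* The shift starts the growth at the unit ball; the radius [j.+1] found is then at most [r], as
   independence requires. *)
have [||j lt_jr slow] := slow_growth (f := fun j => weight w (B j.+1))
    (q := b / 2) (r := r) _ r_gt0; first by lra.
  apply: le_trans (weight_sub w w_gt0 (BV _)) _; apply: le_trans i_max _.
  by rewrite ler_wpM2r // ltW // (weight_gt0 w w_gt0 (center_in_ball _ _ _)).
have [e S_large] : exists e,
    weight w (B j.+1) <= 2 * weight w (parity_ball (H i) v e j.+1).
  have := weightU w w_gt0 (parity_ball (H i) v false j.+1)
    (parity_ball (H i) v true j.+1); rewrite -ball_parity -/B.
  case: (leP (weight w (parity_ball (H i) v false j.+1))
             (weight w (parity_ball (H i) v true j.+1))) => ? ?.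
    by exists true; lra.
  by exists false; lra.
set S := parity_ball _ _ _ _ in S_large.
have SB : S \subset B j.+1 by apply: parity_ball_sub.
have B_gt0 : 0 < weight w (B j.+1).
  exact: (weight_gt0 w w_gt0 (center_in_ball _ _ _)).
have [S0|[s sS]] := set_0Vmem S.
  by move: S_large; rewrite S0 {2}/weight big_set0; lra.
pose V' := S :|: (V :\: B j.+2).
pose L' x := if x \in S then L x :\ i else L x.
have subV' : V' \subset V by rewrite subUset subsetDl (subset_trans SB).
have subL' x : L' x \subset L x by rewrite /L'; case: ifP; rewrite ?subsetDl.
have SiL x : x \in S -> i \in L x.
  by move/(subsetP SB)/inB => /andP[].
have V'_le : weight (fun x => b^-1 ^+ #|L' x|) V' <= 1.
  apply: IHm.
    apply: leq_trans le_m; apply: proper_card; apply/properP; split.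
      apply/subsetP => -[x i'] /=; rewrite !in_set /= -in_setD -in_setU.
      by move=> /andP[/(subsetP subV')-> /(subsetP (subL' x))].
    have sV : s \in V by apply: (subsetP subV'); rewrite inE sS.
    exists (s, i); first by rewrite !inE /= sV SiL.
    by rewrite inE /= /L' sS setD11 andbF.
  (* Such an edge would put [y] in [B j.+2], whose only survivors lie in the independent set [S]. *)
  have lost x y : x \in S -> y \in V' -> i \in L y -> ~~ G i x y.
    move=> xS yV' iy; apply/negP => Gxy.
    have Hxy : H i x y.
      by rewrite /H Gxy iy SiL // !(subsetP subV') // inE xS.
    have yB : y \in B j.+2 by apply: ball_step Hxy; apply: (subsetP SB).
    move: yV'; rewrite !inE yB /= orbF => yS.
    by have := parity_ball_independent _ _ (H_sym i) (no_oddH i) lt_jr xS yS;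
      rewrite Hxy.
  move=> x y xV' yV' neq_xy.
  have [i1 [i1x i1y Gxy]] := complete x y (subsetP subV' _ xV')
    (subsetP subV' _ yV') neq_xy.
  exists i1; split=> //; rewrite /L'; case: ifP => // zS; rewrite !inE ?i1x ?i1y andbT;
    apply/eqP => def_i; subst i1.
    by have := lost _ _ zS yV' i1y; rewrite Gxy.
  by have := lost _ _ zS xV' i1x; rewrite G_sym Gxy.
have SB' : S \subset B j.+2 by apply: subset_trans SB (sub_ballS _ _ _).
apply: le_trans V'_le; rewrite (weightD _ (subsetUl S _ : S \subset V')).
rewrite setDUl setDv set0U setDDl (setUidPl SB').
have -> : weight (fun x => b^-1 ^+ #|L' x|) S = b * weight w S.
  rewrite /weight mulr_sumr; apply: eq_bigr => x xS.
  rewrite /L' xS /w (cardsD1 i (L x)) SiL // exprS mulrA mulfV ?mul1r //.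
  by rewrite gt_eqF.
have -> : weight (fun x => b^-1 ^+ #|L' x|) (V :\: B j.+2) =
    weight w (V :\: B j.+2).
  apply: eq_bigr => x; rewrite inE /L' => /andP[xB _]; case: ifP => // xS.
  by case/negP: xB; apply: (subsetP SB').
(* What remains is that [B j.+2] weighs at most [b / 2] times [B j.+1], hence at most [b] times
   [S]. *)
rewrite (weightD w (BV j.+2)) lerD2r; apply: le_trans slow _.
by rewrite -mulrA ler_pM2l //; lra.
Qed.

(** * Colour classes and the logarithmic bound *)

Lemma colour_class_sym {n k} (c : edge n -> 'I_k) i :
  symmetric (colour_class c i).
Proof. by move=> x y; rewrite /colour_class setUC. Qed.

Lemma colour_class_irr {n k} (c : edge n -> 'I_k) i :
  irreflexive (colour_class c i).
Proof.
move=> x; apply/existsP => -[e /andP[/eqP def_e _]].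
by have := valP e; rewrite def_e setUid cards1.
Qed.

Lemma colour_class_total {n k} (c : edge n -> 'I_k) x y :
  x != y -> exists i, colour_class c i x y.
Proof.
move=> neq_xy; have xy2 : #|[set x; y]| == 2%N by rewrite cards2 neq_xy.
by exists (c (Sub [set x; y] xy2)); apply/existsP; exists (Sub [set x; y] xy2);
  rewrite SubK !eqxx.
Qed.

Lemma le_expr_ceil_logb {R : realType} {a x : R} :
  1 < a -> 1 < x ->
  exists r, [/\ (0 < r)%N, Num.ceil (logb a x) = r%:Z & x <= a ^+ r].
Proof.
move=> a_gt1 x_gt1; have ln_a := ln_gt0 a_gt1; have ln_x := ln_gt0 x_gt1.
have : 0 < Num.ceil (logb a x) by rewrite ceil_gt0 divr_gt0.
have := ceil_ge (logb a x).
case: (Num.ceil _) => // r le_r r_gt0; exists r; split=> //.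
rewrite -ler_ln ?posrE ?exprn_gt0 ?(lt_trans ltr01) // lnXn ?(lt_trans ltr01) //.
by rewrite -mulr_natl -ler_pdivrMr.
Qed.

(** For [k = 1] the logarithm vanishes and the length bound would be 1, below the length of any
    cycle; hence [1 < k]. *)
Theorem theorem2 (R : realType) (k : nat) (hk : (1 < k)%N)
    (b : R) (hb : 2 < b) (n : nat) (hn : b ^+ k < n%:R)
    (c : edge n -> 'I_k) :
  exists s : seq 'I_n,
    [/\ monochromatic_cycle c s,
        odd (size s) &
        ((size s)%:Z <= 2 * Num.ceil (logb (b / 2) k%:R) + 1)%R].
Proof.
have [||r [r_gt0 -> k_le]] := @le_expr_ceil_logb R (b / 2) k%:R.
- by lra.
- by rewrite ltr1n.
apply: contrapT => no_cycle.
have no_odd i s : cycle (colour_class c i) s -> odd (size s) ->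
    (2 * r + 1 < size s)%N.
  move=> cyc_s odd_s; rewrite ltnNge; apply/negP => le_s; apply: no_cycle.
  have [t [cyc_t odd_t le_ts]] :=
    odd_closed_walk_cycle (colour_class_irr c i) cyc_s odd_s.
  exists t; split=> //; first by exists i.
  by rewrite -[_ + 1]/((2 * r + 1)%N%:Z) lez_nat (leq_trans le_ts).
have := @available_colours_weight R _ _ (colour_class c) b r
  (colour_class_sym c) no_odd hb r_gt0 _ [set: 'I_n] (fun=> [set: 'I_k]).
rewrite card_ord => /(_ k_le) weight_le.
have : weight (fun=> b^-1 ^+ #|[set: 'I_k]|) [set: 'I_n] <= 1.
  apply: weight_le => x y _ _ /(colour_class_total c)[i ?].
  by exists i; rewrite !inE.
rewrite /weight sumr_const !cardsT !card_ord.
rewrite exprVn -mulr_natr mulrC ler_pdivrMr ?exprn_gt0 //; last by lra.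
by rewrite mul1r leNgt hn.
Qed.
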